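(* As an identity of formal power series in $q$ (equivalently, of analytic functions for $|q|<1$), $$\sum_{n_1\ge1}\frac{q^{n_1}}{(1-q^{n_1})^2(q^{n_1+1};q)_{\infty}}\sum_{n_2\ge1}\frac{q^{n_1n_2+n_2}}{(1-q^{n_2})^2(q^{n_2+1};q)_{n_1}} =\frac{1}{(q;q)_{\infty}}\left(\sum_{n\ge1}\frac{nq^n}{1-q^n}\right)^2+\frac{1}{(q;q)_{\infty}}\sum_{\substack{n\in\mathbb{Z}\\ n\neq0}}\frac{(-1)^{n}q^{n(n+5)/2}}{(1-q^n)^4}.$$
   Context: Notation: $(a;q)_n=\prod_{k=0}^{n-1}(1-aq^k)$ and $(a;q)_\infty=\prod_{k\ge0}(1-aq^k)$. *)

(* Defs.v *)
From Stdlib Require Import Reals ZArith.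
From Coquelicot Require Import Coquelicot.

Open Scope C_scope.

Definition Cseries (a : nat -> C) : C :=
  @iota C_CompleteNormedModule (@is_series C_AbsRing C_NormedModule a).

(* Sums over n >= 1 are the series of the shifted sequence. *)
Definition Cseries_from1 (a : nat -> C) : C := Cseries (fun k => a (S k)).

Definition Cex_series_from1 (a : nat -> C) : Prop :=
  @ex_series C_AbsRing C_NormedModule (fun k => a (S k)).

Fixpoint qpoch (a q : C) (n : nat) : C :=
  match n with
  | O => 1
  | S m => qpoch a q m * (1 - a * q ^ m)
  end.

Definition is_qpoch_inf (a q l : C) : Prop :=
  filterlim (qpoch a q) eventually (@locally C_UniformSpace l).

Definition qpoch_inf (a q : C) : C :=
  @iota C_CompleteNormedModule (is_qpoch_inf a q).

Definition Cpowz (z : C) (n : Z) : C :=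
  match n with
  | Z0 => 1
  | Zpos p => z ^ Pos.to_nat p
  | Zneg p => / z ^ Pos.to_nat p
  end.

Definition inner_term (q : C) (n1 n2 : nat) : C :=
  q ^ (n1 * n2 + n2) / ((1 - q ^ n2) ^ 2 * qpoch (q ^ (n2 + 1)) q n1).

Definition outer_term (q : C) (n1 : nat) : C :=
  q ^ n1 / ((1 - q ^ n1) ^ 2 * qpoch_inf (q ^ (n1 + 1)) q)
  * Cseries_from1 (inner_term q n1).

Definition lambert_term (q : C) (n : nat) : C :=
  INR n * q ^ n / (1 - q ^ n).

(* For n < 0 the quotient has a removable singularity at q = 0: with n = - m it
   equals (-1)^m q^(m(m+3)/2) / (1 - q^m)^4 for 0 < |q| < 1.  For every n <> 0
   the value of the analytic extension at 0 is 0.  The division n(n+5)/2 in Z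
   is exact. *)
Definition bilateral_term (q : C) (n : Z) : C :=
  if Ceq_dec q 0 then 0
  else Cpowz (- (1)) n * Cpowz q (n * (n + 5) / 2)%Z / (1 - Cpowz q n) ^ 4.

(* The sum over nonzero integers converges when both one-sided sums do. *)
Definition Cex_series_nonzeroZ (a : Z -> C) : Prop :=
  Cex_series_from1 (fun n => a (Z.of_nat n)) /\
  Cex_series_from1 (fun n => a (- Z.of_nat n)%Z).

Definition Cseries_nonzeroZ (a : Z -> C) : C :=
  Cseries_from1 (fun n => a (Z.of_nat n)) +
  Cseries_from1 (fun n => a (- Z.of_nat n)%Z).

(* Main.v *)
(* Write a_n = q^n/(1-q^n)^2, s_m = a_1 + ... + a_m and A = sum a_n.  Multiplied by
   (q;q)_oo the left-hand side is sum_{m,n >= 1} a_m a_n C(m,n) with the connector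
   C(m,n) = q^(mn) (q;q)_m (q;q)_n / (q;q)_(m+n) of Seki and Yamamoto.  The inner sum
   T(m) = sum_n a_n C(m,n) satisfies T(0) = A and, by telescoping,
   T(m-1) - T(m) = a_m, so that T(m) = A - s_m, and the left-hand side is
   A^2 - h_2 with h_2 = sum_m a_m s_m the complete symmetric function of the a_n.
   The partial fraction expansion of prod_n 1/(1 + u a_n) gives
   h_2 = sum_{n >= 1} (-1)^(n-1) q^(n(n-1)/2) (1+q^n) a_n^2: the finite version holds
   by induction on the number of factors, and dominated convergence yields the limit.
   Grouping n with -n, this is minus the bilateral series. *)

Require Import Defs.
From Stdlib Require Import Reals ZArith Lra Lia.
From Coquelicot Require Import Coquelicot.

Open Scope C_scope.

(** * Limits and series of complex numbers *)

(** Reducing complex convergence to a real limit makes squeezing and the algebra of real limits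
    available. [Clim_filterlim] translates back to the filter form used by the series. *)
Definition Clim (u : nat -> C) (l : C) : Prop :=
  is_lim_seq (fun n => Cmod (u n - l)) 0.

Lemma Clim_filterlim (u : nat -> C) (l : C) :
  Clim u l <-> filterlim u eventually (@locally C_UniformSpace l).
Proof.
split.
- intros H P [eps HP].
  apply is_lim_seq_spec in H. destruct (H eps) as [N HN].
  exists N. intros n Hn. apply HP.
  apply C_NormedModule_mixin_compat1.
  specialize (HN n Hn). rewrite Rminus_0_r, Rabs_pos_eq in HN by apply Cmod_ge_0.
  exact HN.
- intros H. apply is_lim_seq_spec. intros eps.
  (* Balls of the uniform structure on C are taken componentwise, so radius r only bounds the
     modulus by sqrt 2 * r. *)
  assert (Hs : (0 < sqrt 2)%R) by (apply sqrt_lt_R0; lra).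
  assert (He : (0 < eps / sqrt 2)%R) by (apply Rdiv_lt_0_compat; [apply cond_pos | exact Hs]).
  destruct (H (ball l (mkposreal _ He))) as [N HN].
  { exists (mkposreal _ He). easy. }
  exists N. intros n Hn. specialize (HN n Hn).
  apply C_NormedModule_mixin_compat2 in HN. simpl in HN.
  rewrite Rminus_0_r, Rabs_pos_eq by apply Cmod_ge_0.
  replace (pos eps) with (sqrt 2 * (eps / sqrt 2))%R by (field; lra).
  exact HN.
Qed.

Lemma Clim_unique (u : nat -> C) (l m : C) : Clim u l -> Clim u m -> m = l.
Proof.
intros Hl Hm.
assert (H : is_lim_seq (fun _ => Cmod (m - l)) 0).
{ apply is_lim_seq_le_le with (u := fun _ => 0%R)
    (w := fun n => (Cmod (u n - m) + Cmod (u n - l))%R).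
  - intros n. split; [apply Cmod_ge_0 |].
    rewrite <- (Cmod_opp (u n - m)).
    replace (m - l) with (- (u n - m) + (u n - l)) by ring. apply Cmod_triangle.
  - apply is_lim_seq_const.
  - replace (Finite 0) with (Finite (0 + 0)) by (f_equal; ring).
    now apply is_lim_seq_plus'. }
apply is_lim_seq_unique in H. rewrite Lim_seq_const in H. injection H as H.
apply Cmod_eq_0 in H. replace m with (m - l + l) by ring. rewrite H. ring.
Qed.

Lemma Clim_le (u : nat -> C) (l : C) (e : nat -> R) :
  (forall n, (Cmod (u n - l) <= e n)%R) -> is_lim_seq e 0 -> Clim u l.
Proof.
intros H He.
apply is_lim_seq_le_le with (u := fun _ => 0%R) (w := e); trivial.
- intros n. split; [apply Cmod_ge_0 | apply H].
- apply is_lim_seq_const.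
Qed.

Lemma Clim_ext (u v : nat -> C) (l : C) :
  (forall n, u n = v n) -> Clim u l -> Clim v l.
Proof. intros H. apply is_lim_seq_ext. intros n. now rewrite H. Qed.

Lemma Clim_const (c : C) : Clim (fun _ => c) c.
Proof.
apply Clim_le with (fun _ => 0%R); [| apply is_lim_seq_const].
intros _. replace (c - c) with (0 : C) by ring. rewrite Cmod_0. lra.
Qed.

Lemma Clim_plus (u v : nat -> C) (l m : C) :
  Clim u l -> Clim v m -> Clim (fun n => u n + v n) (l + m).
Proof.
intros Hu Hv.
apply Clim_le with (fun n => (Cmod (u n - l) + Cmod (v n - m))%R).
- intros n. replace (u n + v n - (l + m)) with ((u n - l) + (v n - m)) by ring.
  apply Cmod_triangle.
- replace (Finite 0) with (Finite (0 + 0)) by (f_equal; ring).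
  now apply is_lim_seq_plus'.
Qed.

Lemma Clim_mult (u v : nat -> C) (l m : C) :
  Clim u l -> Clim v m -> Clim (fun n => u n * v n) (l * m).
Proof.
intros Hu Hv.
apply Clim_le with (fun n => (Cmod (u n - l) * Cmod (v n - m)
  + (Cmod l * Cmod (v n - m) + Cmod m * Cmod (u n - l)))%R).
- intros n.
  replace (u n * v n - l * m)
    with ((u n - l) * (v n - m) + (l * (v n - m) + m * (u n - l))) by ring.
  rewrite <- !Cmod_mult.
  eapply Rle_trans; [apply Cmod_triangle | apply Rplus_le_compat_l, Cmod_triangle].
- replace (Finite 0) with (Finite (0 * 0 + (Cmod l * 0 + Cmod m * 0)))
    by (f_equal; ring).
  repeat apply is_lim_seq_plus'; apply is_lim_seq_mult';
    trivial; apply is_lim_seq_const.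
Qed.

Lemma Clim_opp (u : nat -> C) (l : C) : Clim u l -> Clim (fun n => - u n) (- l).
Proof.
intros H. apply (Clim_ext (fun n => - (1) * u n)); [intros n; ring |].
replace (- l) with (- (1) * l) by ring. apply Clim_mult; trivial. apply Clim_const.
Qed.

Lemma Clim_minus (u v : nat -> C) (l m : C) :
  Clim u l -> Clim v m -> Clim (fun n => u n - v n) (l - m).
Proof. intros Hu Hv. apply Clim_plus; trivial. now apply Clim_opp. Qed.

Lemma Clim_incr (u : nat -> C) (l : C) (k : nat) :
  Clim u l -> Clim (fun n => u (n + k)%nat) l.
Proof. apply (is_lim_seq_incr_n (fun n => Cmod (u n - l)) k). Qed.

(** The bound K keeps the limit away from 0: if l were 0, then 1 = |1/u_n| |u_n| <= K |u_n| would
    tend to 0. *)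
Lemma Clim_inv (u : nat -> C) (l : C) (K : R) :
  (forall n, u n <> 0) -> (forall n, (Cmod (/ u n) <= K)%R) -> Clim u l ->
  l <> 0 /\ Clim (fun n => / u n) (/ l).
Proof.
intros Hn HK H.
assert (Hl : l <> 0).
{ intros ->.
  assert (H1 : is_lim_seq (fun n => K * Cmod (u n - 0))%R 0).
  { replace (Finite 0) with (Finite (K * 0)) by (f_equal; ring).
    apply is_lim_seq_mult'; trivial. apply is_lim_seq_const. }
  apply is_lim_seq_spec in H1. destruct (H1 (mkposreal 1 Rlt_0_1)) as [N HN].
  specialize (HN N (Nat.le_refl _)). simpl in HN.
  replace (u N - 0) with (u N) in HN by ring.
  apply Rabs_def2 in HN.
  pose proof (Rmult_le_compat_r _ _ _ (Cmod_ge_0 (u N)) (HK N)) as H2.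
  rewrite <- Cmod_mult in H2.
  replace (/ u N * u N) with (1 : C) in H2 by (field; apply Hn).
  rewrite Cmod_1 in H2. lra. }
split; trivial.
apply Clim_le with (fun n => (K * Cmod (/ l) * Cmod (u n - l))%R).
- intros n.
  replace (/ u n - / l) with (/ u n * (/ l * - (u n - l))) by (field; split; trivial).
  rewrite !Cmod_mult, Cmod_opp, <- Rmult_assoc.
  apply Rmult_le_compat_r; [apply Cmod_ge_0 |].
  apply Rmult_le_compat_r; [apply Cmod_ge_0 | apply HK].
- replace (Finite 0) with (Finite (K * Cmod (/ l) * 0)) by (f_equal; ring).
  apply is_lim_seq_mult'; trivial. apply is_lim_seq_const.
Qed.

(** * Partial sums, series and dominated convergence *)

Definition Csum (a : nat -> C) (n : nat) : C :=
  @sum_n C_AbelianMonoid a n.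

Lemma Csum_S (a : nat -> C) (n : nat) : Csum a (S n) = Csum a n + a (S n).
Proof. exact (sum_Sn (G := C_AbelianMonoid) a n). Qed.

Lemma Csum_0 (a : nat -> C) : Csum a 0 = a O.
Proof. exact (sum_O (G := C_AbelianMonoid) a). Qed.

Lemma Csum_ext (a b : nat -> C) (n : nat) :
  (forall k, (k <= n)%nat -> a k = b k) -> Csum a n = Csum b n.
Proof. exact (sum_n_ext_loc (G := C_AbelianMonoid) a b n). Qed.

Lemma Csum_mult_l (c : C) (a : nat -> C) (n : nat) :
  Csum (fun k => c * a k) n = c * Csum a n.
Proof.
induction n as [| n IH]; rewrite ?Csum_0, ?Csum_S, ?IH; trivial. ring.
Qed.

Lemma Csum_minus (a b : nat -> C) (n : nat) :
  Csum (fun k => a k - b k) n = Csum a n - Csum b n.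
Proof.
induction n as [| n IH]; rewrite ?Csum_0, ?Csum_S, ?IH; trivial. ring.
Qed.

Lemma Csum_le (a : nat -> C) (b : nat -> R) (n : nat) :
  (forall k, (k <= n)%nat -> (Cmod (a k) <= b k)%R) ->
  (Cmod (Csum a n) <= sum_n b n)%R.
Proof.
induction n as [| n IH]; intros H.
- rewrite Csum_0, sum_O. now apply H.
- rewrite Csum_S, sum_Sn. eapply Rle_trans; [apply Cmod_triangle |].
  apply Rplus_le_compat; [apply IH; intros k Hk |]; apply H; lia.
Qed.

Definition Cis_series (a : nat -> C) (l : C) : Prop :=
  @is_series C_AbsRing C_NormedModule a l.

Lemma Cis_series_Clim (a : nat -> C) (l : C) : Cis_series a l <-> Clim (Csum a) l.
Proof. symmetry. apply Clim_filterlim. Qed.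

Lemma Cseries_unique (a : nat -> C) (l : C) : Cis_series a l -> Cseries a = l.
Proof.
intros H. apply (iota_unique (V := C_CompleteNormedModule)); trivial.
intros m Hm. apply (Clim_unique (Csum a)); now apply Cis_series_Clim.
Qed.

Lemma Cis_series_ext (a b : nat -> C) (l : C) :
  (forall n, a n = b n) -> Cis_series a l -> Cis_series b l.
Proof. intros H. now apply is_series_ext. Qed.

Lemma Cis_series_mult_l (c : C) (a : nat -> C) (l : C) :
  Cis_series a l -> Cis_series (fun n => c * a n) (c * l).
Proof.
rewrite !Cis_series_Clim. intros H.
apply (Clim_ext (fun n => c * Csum a n)); [intros n; now rewrite Csum_mult_l |].
apply Clim_mult; trivial. apply Clim_const.
Qed.

Lemma Cis_series_dominated (a : nat -> C) (b : nat -> R) :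
  (forall n, (Cmod (a n) <= b n)%R) -> ex_series b -> exists l, Cis_series a l.
Proof.
exact (ex_series_le (K := C_AbsRing) (V := C_CompleteNormedModule) a b).
Qed.

Lemma sum_n_le_Series (b : nat -> R) (n : nat) :
  (forall k, (0 <= b k)%R) -> ex_series b -> (sum_n b n <= Series b)%R.
Proof.
intros Hb He.
apply (is_lim_seq_incr_compare (sum_n b)).
- apply Series_correct in He. exact He.
- intros k. rewrite sum_Sn. unfold plus; simpl. specialize (Hb (S k)). lra.
Qed.

(** Dominated convergence for sums whose length grows with the parameter. Cut at a fixed M: the part
    of [Csum (f N) N] beyond M is bounded by the tail of b, the M + 1 first terms converge one by
    one, and the partial sum of g at M is close to l. Each contributes at most eps / 3. *)
Lemma Tannery (f : nat -> nat -> C) (g : nat -> C) (b : nat -> R) (l : C) :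
  ex_series b -> (forall N n, (n <= N)%nat -> (Cmod (f N n) <= b n)%R) ->
  (forall n, Clim (fun N => f N n) (g n)) -> Cis_series g l ->
  Clim (fun N => Csum (f N) N) l.
Proof.
intros Hb Hf Hg Hl. apply Cis_series_Clim in Hl.
assert (Hb0 : forall n, (0 <= b n)%R).
{ intros n. eapply Rle_trans; [apply Cmod_ge_0 | apply (Hf n n (Nat.le_refl _))]. }
apply is_lim_seq_spec. intros eps.
assert (He : (0 < eps / 3)%R) by (apply Rdiv_lt_0_compat; [apply cond_pos | lra]).
pose proof (Series_correct _ Hb) as HB.
assert (HB' : is_lim_seq (sum_n b) (Series b)) by exact HB.
apply is_lim_seq_spec in HB'. destruct (HB' (mkposreal _ He)) as [M1 HM1].
apply is_lim_seq_spec in Hl. destruct (Hl (mkposreal _ He)) as [M2 HM2].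
set (M := Nat.max M1 M2).
assert (Hh : Clim (fun N => Csum (f N) M) (Csum g M)).
{ clear - Hg. induction M as [| M IH].
  - rewrite Csum_0. apply (Clim_ext (fun N => f N O)); trivial.
    intros n; now rewrite Csum_0.
  - rewrite Csum_S. apply (Clim_ext (fun N => Csum (f N) M + f N (S M))).
    + intros n; now rewrite Csum_S.
    + now apply Clim_plus. }
apply is_lim_seq_spec in Hh. destruct (Hh (mkposreal _ He)) as [N0 HN0].
exists (Nat.max M N0). intros N HN.
assert (Hd : forall j, (M + j <= N)%nat ->
  (Cmod (Csum (f N) (M + j) - Csum (f N) M) <= sum_n b (M + j) - sum_n b M)%R).
{ induction j as [| j IH]; intros Hj.
  - rewrite Nat.add_0_r. replace (Csum (f N) M - Csum (f N) M) with (0 : C) by ring.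
    rewrite Cmod_0. lra.
  - rewrite Nat.add_succ_r, Csum_S, sum_Sn. unfold plus; simpl.
    replace (Csum (f N) (M + j) + f N (S (M + j)) - Csum (f N) M)
      with (Csum (f N) (M + j) - Csum (f N) M + f N (S (M + j))) by ring.
    eapply Rle_trans; [apply Cmod_triangle |].
    specialize (IH ltac:(lia)). specialize (Hf N (S (M + j)) ltac:(lia)). lra. }
specialize (Hd (N - M)%nat ltac:(lia)).
replace (M + (N - M))%nat with N in Hd by lia.
specialize (HN0 N ltac:(lia)). specialize (HM2 M ltac:(lia)).
specialize (HM1 M ltac:(lia)). simpl in HN0, HM1, HM2.
rewrite Rminus_0_r, Rabs_pos_eq in HN0, HM2 |- * by apply Cmod_ge_0.
apply Rabs_def2 in HM1.
pose proof (sum_n_le_Series b N Hb0 Hb) as HS.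
replace (Csum (f N) N - l) with ((Csum (f N) N - Csum (f N) M)
  + ((Csum (f N) M - Csum g M) + (Csum g M - l))) by ring.
eapply Rle_lt_trans; [apply Cmod_triangle |].
eapply Rle_lt_trans; [apply Rplus_le_compat_l, Cmod_triangle |].
lra.
Qed.

(** * Geometric series and exchange of summations *)

Lemma ex_series_nat_geom (s : R) :
  (0 <= s < 1)%R -> ex_series (fun n => (INR (S n) * s ^ n)%R).
Proof.
(* The ratio test requires nonzero terms, while s may be 0. The comparison is therefore with a ratio
   t > 0 between s and 1. *)
intros Hs. set (t := ((1 + s) / 2)%R).
assert (Ht : (0 < t < 1)%R) by (unfold t; lra).
assert (Hn : forall n, (0 < INR (S n) * t ^ n)%R).
{ intros n. apply Rmult_lt_0_compat; [apply lt_0_INR; lia | apply pow_lt; lra]. }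
apply (ex_series_le (K := R_AbsRing) (V := R_CompleteNormedModule) _
  (fun n => Rabs (INR (S n) * t ^ n))).
- intros n. unfold norm; simpl; unfold abs; simpl.
  rewrite !Rabs_mult. apply Rmult_le_compat_l; [apply Rabs_pos |].
  rewrite !Rabs_pos_eq by (apply pow_le; lra).
  apply pow_incr. unfold t; lra.
- apply ex_series_DAlembert with t; [lra | intros n; apply Rgt_not_eq, Hn |].
  apply is_lim_seq_ext with (fun n => (t + t * / INR (S n))%R).
  + intros n. rewrite Rabs_pos_eq.
    * rewrite (S_INR (S n)). simpl pow. field. split; [| apply not_0_INR; lia].
      apply pow_nonzero; lra.
    * apply Rlt_le, Rdiv_lt_0_compat; apply Hn.
  + replace (Finite t) with (Finite (t + t * 0)) by (f_equal; ring).
    apply is_lim_seq_plus'; [apply is_lim_seq_const |].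
    apply is_lim_seq_mult'; [apply is_lim_seq_const |].
    apply (is_lim_seq_incr_1 (fun n => / INR n)%R).
    apply (is_lim_seq_inv INR p_infty); [apply is_lim_seq_INR | easy].
Qed.

Lemma ex_series_geom_scal (K s : R) :
  (0 <= s < 1)%R -> ex_series (fun n => (K * s ^ n)%R).
Proof.
intros Hs. apply (ex_series_scal (K := R_AbsRing) (V := R_NormedModule) K).
apply ex_series_geom. rewrite Rabs_pos_eq; lra.
Qed.

Lemma Cone_minus_nz (x : C) : (Cmod x < 1)%R -> 1 - x <> 0.
Proof.
intros Hx H. replace x with (1 : C) in Hx.
- rewrite Cmod_1 in Hx. lra.
- replace (1 : C) with (1 - x + x) by ring. rewrite H. ring.
Qed.

Lemma Clim_Cpow (x : C) : (Cmod x < 1)%R -> Clim (fun n => x ^ n) 0.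
Proof.
intros Hx. apply Clim_le with (fun n => (Cmod x ^ n)%R).
- intros n. replace (x ^ n - 0) with (x ^ n) by ring. rewrite Cmod_pow. lra.
- apply is_lim_seq_geom. rewrite Rabs_pos_eq; [trivial | apply Cmod_ge_0].
Qed.

Lemma Cis_series_geom (x : C) :
  (Cmod x < 1)%R -> Cis_series (fun n => x ^ n) (1 / (1 - x)).
Proof.
intros Hx. pose proof (Cone_minus_nz x Hx) as Hn. apply Cis_series_Clim.
apply (Clim_ext (fun n => (1 - x * x ^ n) * / (1 - x))).
- induction n as [| n IH]; rewrite ?Csum_0, ?Csum_S, <- ?IH; simpl; field; trivial.
- replace (1 / (1 - x)) with ((1 - x * 0) * / (1 - x)) by (field; trivial).
  apply Clim_mult; [| apply Clim_const].
  apply Clim_minus; [apply Clim_const |].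
  apply Clim_mult; [apply Clim_const | now apply Clim_Cpow].
Qed.

Lemma RtoC_INR_S (n : nat) : RtoC (INR (S n)) = INR n + 1.
Proof. now rewrite S_INR, RtoC_plus. Qed.

Lemma Cis_series_nat_geom (x : C) :
  (Cmod x < 1)%R -> Cis_series (fun n => INR (S n) * x ^ S n) (x / (1 - x) ^ 2).
Proof.
intros Hx. pose proof (Cone_minus_nz x Hx) as Hn. apply Cis_series_Clim.
(* Multiplying the partial sum of j x^(j-1) by 1 - x leaves a geometric sum minus a boundary term
   that tends to 0. *)
apply (Clim_ext (fun n => (Csum (fun k => x ^ k) n - INR (S n) * x ^ S n)
  * (x / (1 - x)))).
- induction n as [| n IH]; rewrite ?Csum_0, ?Csum_S, <- ?IH.
  + simpl. field; trivial.
  + rewrite !RtoC_INR_S, !Cpow_S. field; trivial.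
- replace (x / (1 - x) ^ 2) with ((1 / (1 - x) - 0) * (x / (1 - x)))
    by (field; trivial).
  apply Clim_mult; [| apply Clim_const].
  apply Clim_minus; [now apply Cis_series_Clim, Cis_series_geom |].
  apply Clim_le with (fun n => (INR (S n) * Cmod x ^ n)%R).
  + intros n. replace (INR (S n) * x ^ S n - 0) with (INR (S n) * x ^ S n) by ring.
    rewrite Cmod_mult, Cmod_R, Cmod_pow, (Rabs_pos_eq (INR _)) by apply pos_INR.
    apply Rmult_le_compat_l; [apply pos_INR |].
    simpl. rewrite <- (Rmult_1_l (Cmod x ^ n)) at 2.
    apply Rmult_le_compat_r; [apply pow_le, Cmod_ge_0 | lra].
  + apply (ex_series_lim_0 (fun n => (INR (S n) * Cmod x ^ n)%R)).
    apply ex_series_nat_geom. split; [apply Cmod_ge_0 | trivial].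
Qed.

(** Both iterated sums are limits of the same square partial sums over n, k <= N: [Tannery] is
    applied once by rows and once by columns, with the product majorant summed in the other
    index. *)
Lemma Cis_series_exchange (D : nat -> nat -> C) (a b : nat -> R)
    (g h : nat -> C) (l m : C) :
  ex_series a -> ex_series b ->
  (forall n, (0 <= a n)%R) -> (forall k, (0 <= b k)%R) ->
  (forall n k, (Cmod (D n k) <= a n * b k)%R) ->
  (forall n, Cis_series (D n) (g n)) ->
  (forall k, Cis_series (fun n => D n k) (h k)) ->
  Cis_series g l -> Cis_series h m -> l = m.
Proof.
intros Ha Hb Ha0 Hb0 HD Hg Hh Hl Hm.
apply (Clim_unique (fun N => Csum (fun n => Csum (D n) N) N)).
- apply (Clim_ext (fun N => Csum (fun k => Csum (fun n => D n k) N) N)).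
  { intros N. exact (sum_n_switch (G := C_AbelianMonoid) (fun k n => D n k) N N). }
  apply Tannery with h (fun k => (Series a * b k)%R); trivial.
  + now apply (ex_series_scal (K := R_AbsRing) (V := R_NormedModule) (Series a)).
  + intros N k _.
    eapply Rle_trans; [apply (Csum_le _ (fun n => a n * b k)%R); auto |].
    eapply Rle_trans; [apply Req_le, (sum_n_mult_r (K := R_Ring) (b k) a N) |].
    apply Rmult_le_compat_r; trivial.
    now apply sum_n_le_Series.
  + intros k. now apply Cis_series_Clim.
- apply Tannery with g (fun n => (a n * Series b)%R); trivial.
  + now apply ex_series_scal_r.
  + intros N n _.
    eapply Rle_trans; [apply (Csum_le _ (fun k => a n * b k)%R); auto |].
    eapply Rle_trans; [apply Req_le, (sum_n_mult_l (K := R_Ring) (a n) b N) |].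
    apply Rmult_le_compat_l; trivial. now apply sum_n_le_Series.
  + intros k. now apply Cis_series_Clim.
Qed.

(** * The connected sum *)

Section Pochhammer.

Context (q : C) (hq : (Cmod q < 1)%R).

(** * Bounds for (q;q)_n and its inverse, and convergence *)

Lemma Cmod_Cpow_le_1 (n : nat) : (Cmod (q ^ n) <= 1)%R.
Proof using hq.
rewrite Cmod_pow, <- (pow1 n). apply pow_incr. split; [apply Cmod_ge_0 | lra].
Qed.

Lemma Cmod_Cpow_S_le (n : nat) : (Cmod (q ^ S n) <= Cmod q)%R.
Proof using hq.
rewrite Cpow_S, Cmod_mult.
pose proof (Rmult_le_compat_l _ _ _ (Cmod_ge_0 q) (Cmod_Cpow_le_1 n)). lra.
Qed.

Lemma one_minus_Cpow_nz (n : nat) : 1 - q ^ S n <> 0.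
Proof using hq. apply Cone_minus_nz. pose proof (Cmod_Cpow_S_le n). lra. Qed.

Lemma Cmod_one_minus_Cpow_inv (n : nat) :
  (Cmod (/ (1 - q ^ S n)) <= / (1 - Cmod (q ^ S n)))%R.
Proof using hq.
pose proof (Cmod_Cpow_S_le n). rewrite Cmod_inv by apply one_minus_Cpow_nz.
apply Rinv_le_contravar; [lra |].
pose proof (Cmod_triangle (1 - q ^ S n) (q ^ S n)) as Ht.
replace (1 - q ^ S n + q ^ S n) with (1 : C) in Ht by ring.
rewrite Cmod_1 in Ht. lra.
Qed.

Lemma Cmod_one_minus_Cpow_inv_le (n : nat) :
  (Cmod (/ (1 - q ^ S n)) <= / (1 - Cmod q))%R.
Proof using hq.
eapply Rle_trans; [apply Cmod_one_minus_Cpow_inv |].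
apply Rinv_le_contravar; [lra |]. pose proof (Cmod_Cpow_S_le n). lra.
Qed.

Lemma qpoch_S (n : nat) : qpoch q q (S n) = qpoch q q n * (1 - q ^ S n).
Proof using. reflexivity. Qed.

Lemma qpoch_nz (n : nat) : qpoch q q n <> 0.
Proof using hq.
induction n as [| n IH]; [apply C1_nz |].
rewrite qpoch_S. apply Cmult_neq_0; trivial. apply one_minus_Cpow_nz.
Qed.

Lemma qpoch_shift (n k : nat) :
  qpoch (q ^ (n + 1)) q k = qpoch q q (n + k) / qpoch q q n.
Proof using hq.
induction k as [| k IH].
- rewrite Nat.add_0_r. simpl. field. apply qpoch_nz.
- rewrite (Nat.add_succ_r n k), qpoch_S. simpl qpoch. rewrite IH.
  replace (q ^ (n + 1) * q ^ k) with (q ^ S (n + k))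
    by (rewrite <- Cpow_add_r; f_equal; lia).
  field. apply qpoch_nz.
Qed.

Definition qpoch_bound : R := exp (Cmod q / (1 - Cmod q) ^ 2).

(* With r = |q|, both |1 - q^j| and 1/|1 - q^j| are at most
   1 + r^j/(1-r) <= exp (r^j/(1-r)), and these exponents sum to r/(1-r)^2. *)
Lemma qpoch_bounded (n : nat) :
  (Cmod (qpoch q q n) <= qpoch_bound /\ Cmod (/ qpoch q q n) <= qpoch_bound)%R.
Proof using hq.
set (r := Cmod q). pose proof (Cmod_ge_0 q : (0 <= r)%R) as Hr0.
assert (Hr : (r < 1)%R) by exact hq.
(* Closed form of the sum of r^j/(1-r) over 1 <= j <= n. *)
pose (E := fun n => ((1 - r ^ n) * (r / (1 - r) ^ 2))%R).
assert (Hf : (0 <= r / (1 - r) ^ 2)%R).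
{ apply Rdiv_le_0_compat; trivial. apply pow_lt; lra. }
assert (H : forall n, (Cmod (qpoch q q n) <= exp (E n)
                       /\ Cmod (/ qpoch q q n) <= exp (E n))%R).
{ clear n. induction n as [| n [IH1 IH2]].
  - unfold E. simpl. replace (/ 1) with (1 : C) by (field; apply C1_nz).
    rewrite Cmod_1, Rminus_diag, Rmult_0_l, exp_0. lra.
  - set (x := Cmod (q ^ S n)).
    assert (Hx : (0 <= x <= r)%R).
    { split; [apply Cmod_ge_0 | apply Cmod_Cpow_S_le]. }
    assert (HE : E (S n) = (E n + x / (1 - r))%R).
    { unfold E, x. rewrite Cmod_pow. fold r. simpl. field. lra. }
    assert (Hexp : (1 + x / (1 - r) <= exp (x / (1 - r)))%R) by apply exp_ineq1_le.
    assert (Hxr : (x <= x / (1 - r))%R).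
    { apply (Rmult_le_reg_r (1 - r)); [lra |]. field_simplify; [nra | lra]. }
    assert (H1 : (Cmod (1 - q ^ S n) <= exp (x / (1 - r)))%R).
    { eapply Rle_trans; [apply Cmod_triangle |].
      rewrite Cmod_1, Cmod_opp. fold x. lra. }
    assert (H2 : (Cmod (/ (1 - q ^ S n)) <= exp (x / (1 - r)))%R).
    { eapply Rle_trans; [apply Cmod_one_minus_Cpow_inv |]. fold x.
      apply Rle_trans with (1 + x / (1 - r))%R; trivial.
      apply (Rmult_le_reg_r ((1 - x) * (1 - r))); [nra |].
      field_simplify; [nra | lra | lra]. }
    rewrite HE, exp_plus, qpoch_S.
    replace (/ (qpoch q q n * (1 - q ^ S n)))
      with (/ qpoch q q n * / (1 - q ^ S n))
      by (field; split; [apply one_minus_Cpow_nz | apply qpoch_nz]).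
    rewrite !Cmod_mult.
    split; apply Rmult_le_compat; trivial; apply Cmod_ge_0. }
assert (HE : (exp (E n) <= qpoch_bound)%R).
{ unfold qpoch_bound. fold r.
  (* Equality does occur, for r = 0, and [exp_increasing] is strict. *)
  destruct (Req_dec (E n) (r / (1 - r) ^ 2)) as [-> | Hne]; [lra |].
  apply Rlt_le, exp_increasing.
  assert (0 <= r ^ n)%R by (now apply pow_le).
  assert (E n <= r / (1 - r) ^ 2)%R by (unfold E; nra). lra. }
destruct (H n). lra.
Qed.

Lemma qpoch_bound_pos : (0 < qpoch_bound)%R.
Proof using. apply exp_pos. Qed.

(** Since (q;q)_j - (q;q)_(j+1) = (q;q)_j q^(j+1), the products are 1 minus the partial sums of a
    series dominated by a geometric one. The limit is nonzero because the inverses are bounded. *)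
Lemma qpoch_lim :
  exists p : C, p <> 0 /\ Clim (qpoch q q) p /\ Clim (fun n => / qpoch q q n) (/ p).
Proof using hq.
destruct (Cis_series_dominated (fun j => qpoch q q j * q ^ S j)
  (fun j => qpoch_bound * Cmod q * Cmod q ^ j)%R) as [l Hl].
- intros n. rewrite Cmod_mult, Cmod_pow. simpl. rewrite Rmult_assoc.
  apply Rmult_le_compat_r; [| apply qpoch_bounded].
  apply Rmult_le_pos; [apply Cmod_ge_0 | apply pow_le, Cmod_ge_0].
- apply ex_series_geom_scal. split; [apply Cmod_ge_0 | trivial].
- exists (1 - l).
  assert (H : Clim (qpoch q q) (1 - l)).
  { apply (is_lim_seq_incr_1 (fun n => Cmod (qpoch q q n - (1 - l)))).
    change (Clim (fun n => qpoch q q (S n)) (1 - l)).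
    apply (Clim_ext (fun n => 1 - Csum (fun j => qpoch q q j * q ^ S j) n)).
    - induction n as [| n IH].
      + rewrite Csum_0. simpl. ring.
      + rewrite Csum_S, (qpoch_S (S n)), <- IH.
        replace (qpoch q q (S n)) with
          (1 - Csum (fun j => qpoch q q j * q ^ S j) n) by apply IH. ring.
    - apply Clim_minus; [apply Clim_const | now apply Cis_series_Clim]. }
  destruct (Clim_inv _ _ qpoch_bound qpoch_nz (fun n => proj2 (qpoch_bounded n)) H).
  auto.
Qed.

(** * The connector and its telescoping *)

(** This is a_(k+1), so that [Csum square_term m] is s_(m+1). *)
Definition square_term (k : nat) : C := q ^ S k / (1 - q ^ S k) ^ 2.

Definition connector (m n : nat) : C :=
  q ^ (m * n) * qpoch q q m * qpoch q q n / qpoch q q (m + n).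

Lemma connector_sym (m n : nat) : connector m n = connector n m.
Proof using.
unfold connector. rewrite (Nat.mul_comm n m), (Nat.add_comm n m).
unfold Cdiv. ring.
Qed.

Lemma connector_0_l (n : nat) : connector 0 n = 1.
Proof using hq. unfold connector. simpl. field. apply qpoch_nz. Qed.

Lemma connector_0_r (m : nat) : connector m 0 = 1.
Proof using hq. rewrite connector_sym. apply connector_0_l. Qed.

Lemma connector_S_r (m n : nat) :
  connector m (S n) =
  connector m n * (q ^ m * (1 - q ^ S n) / (1 - q ^ S (m + n))).
Proof using hq.
unfold connector. rewrite Nat.mul_succ_r, Cpow_add_r, Nat.add_succ_r, !qpoch_S.
field. split; [apply one_minus_Cpow_nz | apply qpoch_nz].
Qed.

(** Both sides equal q^m (1-q^m) C(m,n) / (1-q^(m+n+1)). Neither q^m nor 1 - q^m is divided out,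
    since q or m may be 0. *)
Lemma connector_diff_r (m n : nat) :
  q ^ m * (connector m n - connector m (S n)) =
  (1 - q ^ m) * (connector m (S n) / (1 - q ^ S n)).
Proof using hq.
rewrite connector_S_r. pose proof (one_minus_Cpow_nz (m + n)) as H.
revert H. simpl. rewrite Cpow_add_r. intros H.
field. split; [exact H | exact (one_minus_Cpow_nz n)].
Qed.

Lemma connector_diff_l (m n : nat) :
  q ^ n * (connector m n - connector (S m) n) =
  (1 - q ^ n) * (connector (S m) n / (1 - q ^ S m)).
Proof using hq. rewrite !(connector_sym _ n). apply connector_diff_r. Qed.

Lemma connector_bound (m n : nat) :
  (Cmod (connector m n) <= qpoch_bound ^ 3 * Cmod q ^ (m * n))%R.
Proof using hq.
unfold connector, Cdiv. rewrite !Cmod_mult, Cmod_pow.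
destruct (qpoch_bounded m) as [Hm _], (qpoch_bounded n) as [Hn _],
  (qpoch_bounded (m + n)) as [_ Hmn].
replace (qpoch_bound ^ 3 * Cmod q ^ (m * n))%R
  with (Cmod q ^ (m * n) * qpoch_bound * qpoch_bound * qpoch_bound)%R by ring.
repeat (apply Rmult_le_compat; trivial; try apply Rmult_le_pos;
  try apply Rmult_le_pos; try apply Cmod_ge_0; try apply pow_le, Cmod_ge_0).
lra.
Qed.

(** By [connector_diff_r] the terms telescope: each is q^(m+1)/(1-q^(m+1)) times a difference of
    consecutive values of C(m+1, .), which starts at C(m+1,0) = 1 and tends to 0. *)
Lemma connector_row_series (m : nat) :
  Cis_series (fun k => connector (S m) (S k) / (1 - q ^ S k))
    (q ^ S m / (1 - q ^ S m)).
Proof using hq.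
apply Cis_series_Clim.
apply (Clim_ext (fun n => q ^ S m / (1 - q ^ S m) * (1 - connector (S m) (S n)))).
- pose proof (one_minus_Cpow_nz m) as Hm.
  assert (H : forall n, connector (S m) (S n) / (1 - q ^ S n) =
    q ^ S m / (1 - q ^ S m) * (connector (S m) n - connector (S m) (S n))).
  { intros n. pose proof (connector_diff_r (S m) n) as H.
    transitivity (/ (1 - q ^ S m) *
      ((1 - q ^ S m) * (connector (S m) (S n) / (1 - q ^ S n)))).
    - field. split; [apply one_minus_Cpow_nz | trivial].
    - rewrite <- H. field. trivial. }
  induction n as [| n IH]; rewrite ?Csum_0, ?Csum_S, <- ?IH, H, ?connector_0_r; ring.
- set (a := q ^ S m / (1 - q ^ S m)).
  cut (Clim (fun n => a * (1 - connector (S m) (S n))) (a * (1 - 0))).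
  { replace (a * (1 - 0)) with a by ring. trivial. }
  apply Clim_mult; [apply Clim_const |].
  apply Clim_minus; [apply Clim_const |].
  apply Clim_le with (fun n => qpoch_bound ^ 3 * Cmod q ^ n)%R.
  + intros n. replace (connector (S m) (S n) - 0) with (connector (S m) (S n)) by ring.
    eapply Rle_trans; [apply connector_bound |].
    apply Rmult_le_compat_l; [apply pow_le, Rlt_le, qpoch_bound_pos |].
    replace (S m * S n)%nat with (n + (1 + m + m * n))%nat by lia.
    rewrite pow_add, <- !Cmod_pow.
    pose proof (Rmult_le_compat_l _ _ _ (Cmod_ge_0 (q ^ n))
      (Cmod_Cpow_le_1 (1 + m + m * n))). lra.
  + replace (Finite 0) with (Finite (qpoch_bound ^ 3 * 0)) by (f_equal; ring).
    apply is_lim_seq_mult'; [apply is_lim_seq_const |].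
    apply is_lim_seq_geom. rewrite Rabs_pos_eq; [trivial | apply Cmod_ge_0].
Qed.

(** The step T(m) - T(m+1) = a_(m+1). By [connector_diff_l], a_n (C(m,n) - C(m+1,n)) is C(m+1,n) /
    ((1-q^n)(1-q^(m+1))), and [connector_row_series] sums this over n. *)
Lemma connected_series_S (m : nat) (t : C) :
  Cis_series (fun k => square_term k * connector m (S k)) t ->
  Cis_series (fun k => square_term k * connector (S m) (S k)) (t - square_term m).
Proof using hq.
intros H. pose proof (connector_row_series m) as Hr.
apply (Cis_series_mult_l (/ (1 - q ^ S m))) in Hr.
rewrite Cis_series_Clim in H, Hr |- *.
pose proof (Clim_minus _ _ _ _ H Hr) as Hd.
replace (/ (1 - q ^ S m) * (q ^ S m / (1 - q ^ S m))) with (square_term m) in Hd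
  by (unfold square_term; field; apply one_minus_Cpow_nz).
eapply Clim_ext; [| exact Hd].
intros n. cbv beta. rewrite <- Csum_minus. apply Csum_ext. intros k _.
pose proof (connector_diff_l m (S k)) as Hk.
pose proof (one_minus_Cpow_nz m) as Hm. pose proof (one_minus_Cpow_nz k) as Hk0.
unfold square_term.
transitivity (/ (1 - q ^ S k) ^ 2 * (q ^ S k * connector m (S k)
  - (1 - q ^ S k) * (connector (S m) (S k) / (1 - q ^ S m)))).
- field. auto.
- rewrite <- Hk. field. trivial.
Qed.

Lemma connected_series (A : C) :
  Cis_series square_term A ->
  forall m, Cis_series (fun k => square_term k * connector (S m) (S k))
    (A - Csum square_term m).
Proof using hq.
intros HA. induction m as [| m IH].
- rewrite Csum_0. apply connected_series_S. revert HA. apply Cis_series_ext.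
  intros n. rewrite connector_0_l. ring.
- rewrite Csum_S.
  replace (A - (Csum square_term m + square_term (S m)))
    with (A - Csum square_term m - square_term (S m)) by ring.
  now apply connected_series_S.
Qed.

(** * Finite partial fractions *)

Fixpoint triangular (k : nat) : nat :=
  match k with O => O | S j => (triangular j + S j)%nat end.

(** With n = k+1 this is (-1)^(n-1) q^(n(n-1)/2) (1+q^n), the coefficient of a_n^2 in the expansion
    of h_2. *)
Definition limit_weight (k : nat) : C :=
  (- (1)) ^ k * q ^ triangular k * (1 + q ^ S k).

(* With a_n = q^n/(1-q^n)^2 one has, for 0 <= k <= N,
   pf_weight N k = prod_{1 <= m <= N+1, m <> k+1} (1 - a_m/a_{k+1})^(-1). *)
Definition pf_weight (N k : nat) : C :=
  limit_weight k * qpoch q q (S N) ^ 2 / (qpoch q q (N - k) * qpoch q q (S N + S k)).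

(* The right-hand side is the antidifference found by Gosper's algorithm; at i = 0
   it reduces to 1. *)
Lemma pf_weight_partial_sum (j i : nat) :
  Csum (pf_weight (j + i)) j =
  1 + (- (1)) ^ j * q ^ triangular (S j) * (1 - q ^ i) * qpoch q q (S (j + i)) ^ 2
      / ((1 - q ^ S (j + i)) * qpoch q q i * qpoch q q (S (j + i) + S j)).
Proof using hq.
revert i. induction j as [| j IH]; intros i.
- rewrite Csum_0. unfold pf_weight, limit_weight. rewrite Nat.sub_0_r.
  replace (S (0 + i) + 1)%nat with (S (S i)) by lia. simpl (0 + i)%nat.
  rewrite !qpoch_S.
  pose proof (one_minus_Cpow_nz i) as H1. pose proof (one_minus_Cpow_nz (S i)) as H2.
  pose proof (qpoch_nz i) as H3.
  revert H1 H2. simpl. intros H1 H2. field. auto.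
(* The upper parameter N = j + 1 + i stays fixed while the length shrinks, so the induction
   hypothesis is taken at i + 1. *)
- rewrite Csum_S. replace (S j + i)%nat with (j + S i)%nat by lia. rewrite IH.
  unfold pf_weight, limit_weight. replace (j + S i - S j)%nat with i by lia.
  replace (S (j + S i) + S (S j))%nat with (S (S (j + S i) + S j)) by lia.
  rewrite !(qpoch_S i), (qpoch_S (S (j + S i) + S j)).
  pose proof (one_minus_Cpow_nz i) as H1.
  pose proof (one_minus_Cpow_nz (j + S i)) as H2.
  pose proof (one_minus_Cpow_nz (S (j + S i) + S j)) as H3.
  pose proof (qpoch_nz i) as H4. pose proof (qpoch_nz (S (j + S i) + S j)) as H5.
  set (P1 := qpoch q q (S (j + S i))).
  set (P2 := qpoch q q (S (j + S i) + S j)) in *.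
  set (P3 := qpoch q q i) in *.
  replace (q ^ S (S (j + S i) + S j)) with (q * (q * (q ^ j * (q * q ^ i))) * (q * q ^ j)) in *
    by (rewrite <- !Cpow_S, <- !Cpow_add_r; simpl; try rewrite <- !Cpow_S, <- !Cpow_add_r;
        f_equal; lia).
  replace (q ^ S (j + S i)) with (q * (q ^ j * (q * q ^ i))) in *
    by (rewrite <- !Cpow_S, <- !Cpow_add_r; simpl; f_equal; lia).
  replace (q ^ triangular (S (S j))) with (q ^ triangular (S j) * (q * (q * q ^ j)))
    by (change (triangular (S (S j))) with (triangular (S j) + S (S j))%nat;
        now rewrite Cpow_add_r, !Cpow_S).
  rewrite !Cpow_S in *.
  set (T := q ^ triangular (S j)). set (x := q ^ i) in *. set (y := q ^ j) in *.
  set (s := (- (1)) ^ j).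
  (* What remains is a rational identity in which powers, sign and Pochhammer values are free
     variables. *)
  clearbody P1 P2 P3 T x y s.
  field. auto.
Qed.

(** The value at u = 0 of the partial fraction expansion of prod 1/(1 + u a_m), 1 <= m <= N+1, as
    the sum of [pf_weight N k] / (1 + u a_(k+1)). *)
Lemma pf_weight_sum (N : nat) : Csum (pf_weight N) N = 1.
Proof using hq.
pose proof (pf_weight_partial_sum N 0) as H. rewrite Nat.add_0_r in H. rewrite H.
simpl (q ^ 0). unfold Cdiv. ring.
Qed.

(** A new factor 1/(1 + u a_(N+2)) divides the old weight by 1 - a_(N+2)/a_(k+1); this is that
    relation multiplied out. *)
Lemma pf_weight_S (N k : nat) :
  (k <= N)%nat ->
  pf_weight (S N) k * square_term k =
  pf_weight N k * square_term k + pf_weight (S N) k * square_term (S N).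
Proof using hq.
intros Hk. destruct (Nat.le_exists_sub _ _ Hk) as [i [-> _]].
unfold pf_weight, square_term.
replace (S (i + k) - k)%nat with (S i) by lia. replace (i + k - k)%nat with i by lia.
replace (S (S (i + k)) + S k)%nat with (S (S (i + k) + S k)) by lia.
rewrite (qpoch_S i), (qpoch_S (S (i + k))), (qpoch_S (S (i + k) + S k)).
pose proof (one_minus_Cpow_nz i) as H1.
pose proof (one_minus_Cpow_nz k) as H2.
pose proof (one_minus_Cpow_nz (S (i + k))) as H3.
pose proof (one_minus_Cpow_nz (S (i + k) + S k)) as H4.
pose proof (qpoch_nz i) as H5. pose proof (qpoch_nz (S (i + k) + S k)) as H6.
set (P1 := qpoch q q (S (i + k))).
set (P2 := qpoch q q (S (i + k) + S k)) in *.
set (P3 := qpoch q q i) in *. set (L := limit_weight k).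
replace (q ^ S (S (i + k) + S k)) with (q * (q * (q ^ i * q ^ k)) * (q * q ^ k)) in *
  by (rewrite <- !Cpow_S, <- !Cpow_add_r; simpl; try rewrite <- !Cpow_S, <- !Cpow_add_r;
      f_equal; lia).
replace (q ^ S (S (i + k))) with (q * (q * (q ^ i * q ^ k))) in *
  by (rewrite <- !Cpow_add_r, <- !Cpow_S; f_equal; lia).
rewrite !Cpow_S in *.
set (x := q ^ i) in *. set (y := q ^ k) in *.
clearbody P1 P2 P3 L x y.
field. repeat split; auto.
Qed.

(** For k <= N this is [pf_weight_S] summed against e; the new index k = N+1 contributes the same
    term to both sides. Taking e = 1 and e = [square_term] gives the recursions h_j(N+1) = h_j(N) +
    a_(N+2) h_(j-1)(N+1) of the complete symmetric functions for j = 1, 2. *)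
Lemma pf_weight_moment_S (e : nat -> C) (N : nat) :
  Csum (fun k => pf_weight (S N) k * square_term k * e k) (S N) =
  Csum (fun k => pf_weight N k * square_term k * e k) N
  + square_term (S N) * Csum (fun k => pf_weight (S N) k * e k) (S N).
Proof using hq.
rewrite <- Csum_mult_l, !Csum_S.
assert (H : forall M, (M <= N)%nat ->
  Csum (fun k => pf_weight (S N) k * square_term k * e k) M =
  Csum (fun k => pf_weight N k * square_term k * e k) M
  + Csum (fun k => square_term (S N) * (pf_weight (S N) k * e k)) M).
{ induction M as [| M IH]; intros HM.
  - rewrite !Csum_0, pf_weight_S by lia. ring.
  - rewrite !Csum_S, IH, pf_weight_S by lia. ring. }
rewrite H by lia. ring.
Qed.

Lemma pf_weight_moment1 (N : nat) :
  Csum (fun k => pf_weight N k * square_term k) N = Csum square_term N.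
Proof using hq.
induction N as [| N IH].
- pose proof (pf_weight_sum 0) as H. rewrite Csum_0 in H |- *. rewrite H, Csum_0. ring.
- pose proof (pf_weight_moment_S (fun _ => 1) N) as H.
  rewrite (Csum_ext _ (fun k => pf_weight (S N) k * square_term k * 1))
    by (intros; ring).
  rewrite H, (Csum_S square_term), <- IH.
  rewrite (Csum_ext (fun k => pf_weight (S N) k * 1) (pf_weight (S N)))
    by (intros; ring).
  rewrite pf_weight_sum, Cmult_1_r. f_equal. apply Csum_ext. intros; ring.
Qed.

Lemma pf_weight_moment2 (N : nat) :
  Csum (fun k => pf_weight N k * square_term k * square_term k) N =
  Csum (fun m => square_term m * Csum square_term m) N.
Proof using hq.
induction N as [| N IH].
- pose proof (pf_weight_sum 0) as H. rewrite Csum_0 in H |- *. rewrite H, !Csum_0. ring.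
- now rewrite pf_weight_moment_S, IH, pf_weight_moment1, (Csum_S (fun m => square_term m * _)).
Qed.

(** * Passage to the limit *)

Lemma square_term_bound (k : nat) :
  (Cmod (square_term k) <= / (1 - Cmod q) ^ 2 * Cmod q ^ k)%R.
Proof using hq.
pose proof (Cmod_one_minus_Cpow_inv_le k) as H.
pose proof (Cmod_ge_0 q) as H0. pose proof (pow_le _ k H0) as H1.
unfold square_term.
replace (q ^ S k / (1 - q ^ S k) ^ 2)
  with (q * q ^ k * (/ (1 - q ^ S k) * / (1 - q ^ S k)))
  by (rewrite <- Cpow_S; field; apply one_minus_Cpow_nz).
rewrite !Cmod_mult, Cmod_pow.
replace (/ (1 - Cmod q) ^ 2 * Cmod q ^ k)%R
  with (1 * Cmod q ^ k * (/ (1 - Cmod q) * / (1 - Cmod q)))%R by (field; lra).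
pose proof (Cmod_ge_0 (/ (1 - q ^ S k))).
apply Rmult_le_compat; nra.
Qed.

Lemma square_series : exists A : C, Cis_series square_term A.
Proof using hq.
apply (Cis_series_dominated _ _ square_term_bound).
apply ex_series_geom_scal. split; [apply Cmod_ge_0 | trivial].
Qed.

Lemma Cmod_limit_weight (k : nat) : (Cmod (limit_weight k) <= 2)%R.
Proof using hq.
unfold limit_weight. rewrite !Cmod_mult.
rewrite (Cmod_pow (- (1))), Cmod_opp, Cmod_1, pow1, Rmult_1_l.
pose proof (Cmod_Cpow_le_1 (triangular k)) as H1.
pose proof (Cmod_Cpow_le_1 (S k)) as H2.
pose proof (Cmod_triangle 1 (q ^ S k)) as H3. rewrite Cmod_1 in H3.
pose proof (Cmod_ge_0 (q ^ triangular k)). pose proof (Cmod_ge_0 (1 + q ^ S k)).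
nra.
Qed.

(** Uniformity in N is what the domination in [Tannery] asks for: 2 bounds [limit_weight k], and
    each of the four Pochhammer factors costs one [qpoch_bound]. *)
Lemma pf_weight_bound (N k : nat) : (Cmod (pf_weight N k) <= 2 * qpoch_bound ^ 4)%R.
Proof using hq.
unfold pf_weight.
replace (limit_weight k * qpoch q q (S N) ^ 2
    / (qpoch q q (N - k) * qpoch q q (S N + S k)))
  with (limit_weight k * (qpoch q q (S N) * qpoch q q (S N)
    * (/ qpoch q q (N - k) * / qpoch q q (S N + S k))))
  by (field; split; apply qpoch_nz).
rewrite !Cmod_mult.
replace (2 * qpoch_bound ^ 4)%R with
  (2 * (qpoch_bound * qpoch_bound * (qpoch_bound * qpoch_bound)))%R by ring.
repeat (apply Rmult_le_compat); try (apply qpoch_bounded || apply Cmod_limit_weight);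
  repeat apply Rmult_le_pos; apply Cmod_ge_0.
Qed.

(** All four Pochhammer factors tend to p = (q;q)_oo, two above and two below, and cancel. *)
Lemma pf_weight_lim (k : nat) : Clim (fun N => pf_weight N k) (limit_weight k).
Proof using hq.
destruct qpoch_lim as (p & Hp & HP & HPi).
(* Starting at N = n + k makes the truncated difference N - k equal to n. *)
apply (is_lim_seq_incr_n (fun N => Cmod (pf_weight N k - limit_weight k)) k).
apply (Clim_ext (fun n => limit_weight k * (qpoch q q (n + S k) * qpoch q q (n + S k))
  * (/ qpoch q q n * / qpoch q q (n + (S k + S k))))).
- intros n. unfold pf_weight. replace (n + k - k)%nat with n by lia.
  replace (S (n + k)) with (n + S k)%nat by lia.
  rewrite Nat.add_assoc. field. split; apply qpoch_nz.
- cut (Clim (fun n => limit_weight k * (qpoch q q (n + S k) * qpoch q q (n + S k))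
    * (/ qpoch q q n * / qpoch q q (n + (S k + S k))))
    (limit_weight k * (p * p) * (/ p * / p))).
  { replace (limit_weight k * (p * p) * (/ p * / p)) with (limit_weight k)
      by (field; trivial). trivial. }
  repeat apply Clim_mult; trivial; try apply Clim_const;
    apply (Clim_incr (qpoch q q)) || apply (Clim_incr (fun n => / qpoch q q n));
    trivial.
Qed.

(** One factor [square_term k] supplies the geometric decay, the other is only bounded. *)
Lemma weighted_square_bound (x : C) (M : R) (k : nat) :
  (Cmod x <= M)%R ->
  (Cmod (x * square_term k * square_term k)
   <= M * (/ (1 - Cmod q) ^ 2 * / (1 - Cmod q) ^ 2) * Cmod q ^ k)%R.
Proof using hq.
intros Hx. rewrite !Cmod_mult.
pose proof (square_term_bound k) as Hs.
pose proof (Cmod_ge_0 (square_term k)) as Hs0.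
assert (Hi : (0 < / (1 - Cmod q) ^ 2)%R) by (apply Rinv_0_lt_compat, pow_lt; lra).
assert (Hs1 : (Cmod (square_term k) <= / (1 - Cmod q) ^ 2)%R).
{ eapply Rle_trans; [exact Hs |]. rewrite <- Cmod_pow.
  pose proof (Cmod_Cpow_le_1 k). nra. }
rewrite !Rmult_assoc.
apply Rmult_le_compat; trivial; try apply Cmod_ge_0.
- now apply Rmult_le_pos.
- now apply Rmult_le_compat.
Qed.

Lemma weighted_square_series (x : nat -> C) (M : R) :
  (forall k, (Cmod (x k) <= M)%R) ->
  exists l : C, Cis_series (fun k => x k * square_term k * square_term k) l.
Proof using hq.
intros Hx.
eapply Cis_series_dominated; [intros k; apply weighted_square_bound, Hx |].
apply ex_series_geom_scal. split; [apply Cmod_ge_0 | trivial].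
Qed.

(** The second moments of the finite weights are the partial sums of h_2; dominated convergence
    identifies their limit with the series of the limiting weights. *)
Lemma limit_weight_series :
  exists V : C,
    Cis_series (fun k => limit_weight k * square_term k * square_term k) V /\
    Clim (Csum (fun m => square_term m * Csum square_term m)) V.
Proof using hq.
destruct (weighted_square_series limit_weight 2 Cmod_limit_weight) as [V HV].
exists V. split; trivial.
apply (Clim_ext _ _ _ pf_weight_moment2).
eapply Tannery; [| intros N k _; apply weighted_square_bound, pf_weight_bound | | exact HV].
- apply ex_series_geom_scal. split; [apply Cmod_ge_0 | trivial].
- intros k. apply Clim_mult; [apply Clim_mult |]; try apply Clim_const.
  apply pf_weight_lim.
Qed.

(** * The Lambert series and the inner sum *)

(** Sum n q^(nk) over n, k >= 1 in both orders: over k it gives n q^n/(1-q^n), over n it gives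
    q^k/(1-q^k)^2. *)
Lemma lambert_series (A : C) :
  Cis_series square_term A -> Cis_series (fun n => lambert_term q (S n)) A.
Proof using hq.
intros HA. pose proof (Cmod_ge_0 q) as Hq0.
assert (Hx : forall n, (Cmod (q ^ S n) < 1)%R).
{ intros n. pose proof (Cmod_Cpow_S_le n). lra. }
destruct (Cis_series_dominated (fun n => lambert_term q (S n))
  (fun n => (INR (S n) * Cmod q ^ n) * / (1 - Cmod q))%R) as [L HL].
- intros n. unfold lambert_term, Cdiv. rewrite !Cmod_mult.
  pose proof (pos_INR (S n)) as Hn.
  apply Rmult_le_compat; try apply Rmult_le_pos; try apply Cmod_ge_0.
  + rewrite Cmod_R, Rabs_pos_eq by trivial.
    apply Rmult_le_compat_l; trivial.
    rewrite Cpow_S, Cmod_mult, Cmod_pow.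
    pose proof (pow_le _ n Hq0). nra.
  + apply Cmod_one_minus_Cpow_inv_le.
- apply ex_series_scal_r, ex_series_nat_geom. auto.
- enough (L = A) as <- by exact HL.
  apply (Cis_series_exchange (fun n k => INR (S n) * q ^ (S n * S k))
    (fun n => INR (S n) * Cmod q ^ n)%R (fun k => 1 * Cmod q ^ k)%R
    (fun n => lambert_term q (S n)) square_term); trivial.
  + apply ex_series_nat_geom. auto.
  + apply ex_series_geom_scal. auto.
  + intros n. apply Rmult_le_pos; [apply pos_INR | now apply pow_le].
  + intros k. apply Rmult_le_pos; [lra | now apply pow_le].
  + intros n k. rewrite Cmod_mult, Cmod_R, Rabs_pos_eq by apply pos_INR.
    rewrite Rmult_assoc. apply Rmult_le_compat_l; [apply pos_INR |].
    (* This splitting of the exponent produces the product majorant (n+1) |q|^n |q|^k. *)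
    replace (S n * S k)%nat with (n + (k + S (n * k)))%nat by lia.
    rewrite !Cpow_add_r, !Cmod_mult, !Cmod_pow, Rmult_1_l.
    apply Rmult_le_compat_l; [now apply pow_le |].
    pose proof (Cmod_Cpow_le_1 (S (n * k))) as H. rewrite Cmod_pow in H.
    pose proof (pow_le _ k Hq0). nra.
  + intros n.
    replace (lambert_term q (S n)) with (INR (S n) * q ^ S n * (1 / (1 - q ^ S n)))
      by (unfold lambert_term; field; apply one_minus_Cpow_nz).
    apply (Cis_series_ext (fun k => INR (S n) * q ^ S n * (q ^ S n) ^ k)).
    * intros k. rewrite Nat.mul_succ_r, Nat.add_comm, Cpow_add_r, Cpow_mult_r. ring.
    * now apply Cis_series_mult_l, Cis_series_geom.
  + intros k.
    apply (Cis_series_ext (fun n => INR (S n) * (q ^ S k) ^ S n)).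
    * intros n. now rewrite Nat.mul_comm, Cpow_mult_r.
    * now apply Cis_series_nat_geom.
Qed.

(** By [qpoch_shift], 1/(q^(n2+1);q)_n1 = (q;q)_n2/(q;q)_(n1+n2), so the inner term is a_n2 C(n1,n2)
    / (q;q)_n1. *)
Lemma inner_series (A : C) (m : nat) :
  Cis_series square_term A ->
  Cis_series (fun k => inner_term q (S m) (S k))
    ((A - Csum square_term m) / qpoch q q (S m)).
Proof using hq.
intros HA.
pose proof (Cis_series_mult_l (/ qpoch q q (S m)) _ _ (connected_series A HA m)) as H.
replace ((A - Csum square_term m) / qpoch q q (S m))
  with (/ qpoch q q (S m) * (A - Csum square_term m)) by (unfold Cdiv; ring).
revert H. apply Cis_series_ext. intros k.
unfold inner_term, square_term, connector.
rewrite qpoch_shift, Cpow_add_r, (Nat.add_comm (S k)).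
field. repeat split; try apply qpoch_nz; apply one_minus_Cpow_nz.
Qed.

Lemma qpoch_inf_shift (p : C) (n : nat) :
  Clim (qpoch q q) p -> is_qpoch_inf (q ^ (n + 1)) q (p / qpoch q q n).
Proof using hq.
intros H. apply Clim_filterlim.
apply (Clim_ext (fun k => qpoch q q (k + n) * / qpoch q q n)).
- intros k. rewrite qpoch_shift, Nat.add_comm. reflexivity.
- apply Clim_mult; [now apply Clim_incr | apply Clim_const].
Qed.

Lemma qpoch_inf_unique (a l : C) : is_qpoch_inf a q l -> qpoch_inf a q = l.
Proof using.
intros H. apply (iota_unique (V := C_CompleteNormedModule)); trivial.
intros m Hm. apply (Clim_unique (qpoch a q)); now apply Clim_filterlim.
Qed.

(** * The bilateral series *)

Lemma triangular_double (k : nat) : (2 * triangular k = k * (k + 1))%nat.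
Proof using. induction k as [| k IH]; simpl triangular; lia. Qed.

Lemma Cpowz_of_nat (z : C) (n : nat) : Cpowz z (Z.of_nat n) = z ^ n.
Proof using.
destruct n as [| n]; trivial.
change (z ^ Pos.to_nat (Pos.of_succ_nat n) = z ^ S n). now rewrite SuccNat2Pos.id_succ.
Qed.

Lemma Cpowz_opp_of_nat (z : C) (n : nat) : Cpowz z (- Z.of_nat n) = / z ^ n.
Proof using.
destruct n as [| n].
- simpl. field.
- change (/ z ^ Pos.to_nat (Pos.of_succ_nat n) = / z ^ S n). now rewrite SuccNat2Pos.id_succ.
Qed.

Lemma Cpowz_sub (z : C) (a b : nat) :
  z <> 0 -> Cpowz z (Z.of_nat a - Z.of_nat b) = z ^ a / z ^ b.
Proof using.
intros Hz. destruct (Nat.le_ge_cases b a) as [H | H];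
  destruct (Nat.le_exists_sub _ _ H) as [c [-> _]].
- replace (Z.of_nat (c + b) - Z.of_nat b)%Z with (Z.of_nat c) by lia.
  rewrite Cpowz_of_nat, Cpow_add_r. field. now apply Cpow_nz.
- replace (Z.of_nat a - Z.of_nat (c + a))%Z with (- Z.of_nat c)%Z by lia.
  rewrite Cpowz_opp_of_nat, Cpow_add_r. field. split; now apply Cpow_nz.
Qed.

(** With n = k+1, n(n+5)/2 = n(n-1)/2 + 3n; two of the three factors q^n complete a_n^2. *)
Lemma bilateral_term_pos (k : nat) :
  bilateral_term q (Z.of_nat (S k)) =
  - ((- (1)) ^ k * q ^ triangular k * q ^ S k) * square_term k * square_term k.
Proof using hq.
unfold bilateral_term, square_term. destruct (Ceq_dec q 0) as [-> | Hq].
(* At q = 0 the default value 0 agrees with the right-hand side, since [square_term k] vanishes. *)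
- rewrite (Cpow_S 0). unfold Cdiv. ring.
- rewrite !Cpowz_of_nat.
  replace (Z.of_nat (S k) * (Z.of_nat (S k) + 5) / 2)%Z
    with (Z.of_nat (triangular k + S k + S k + S k)).
  + rewrite Cpowz_of_nat, !Cpow_add_r, (Cpow_S (- (1))).
    field. apply one_minus_Cpow_nz.
  + apply Z.div_unique_exact; [easy |]. pose proof (triangular_double k). nia.
Qed.

(** With m = k+1 the exponent of q is m(m-1)/2 - 2m, and 1/(1-q^(-m))^4 = q^(4m)/(1-q^m)^4, which
    leaves q^(2m) for a_m^2. *)
Lemma bilateral_term_neg (k : nat) :
  bilateral_term q (- Z.of_nat (S k)) =
  - ((- (1)) ^ k * q ^ triangular k) * square_term k * square_term k.
Proof using hq.
unfold bilateral_term, square_term. destruct (Ceq_dec q 0) as [-> | Hq].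
- rewrite (Cpow_S 0). unfold Cdiv. ring.
- rewrite !Cpowz_opp_of_nat.
  replace (- Z.of_nat (S k) * (- Z.of_nat (S k) + 5) / 2)%Z
    with (Z.of_nat (triangular k) - Z.of_nat (S k + S k))%Z.
  + rewrite Cpowz_sub, !Cpow_add_r, (Cpow_S (- (1))) by trivial.
    pose proof (one_minus_Cpow_nz k) as H1. pose proof (Cpow_nz q (S k) Hq) as H2.
    (* The sign comes from a negative power of -1, which is its own inverse. *)
    assert (Hs : / ((- (1)) ^ k) = (- (1)) ^ k).
    { rewrite <- Cpow_inv by (intros H; apply C1_nz;
        replace (1 : C) with (- - (1)) by ring; rewrite H; ring).
      f_equal. field. }
    replace (/ (- (1) * (- (1)) ^ k)) with (- / ((- (1)) ^ k)).
    * rewrite Hs. field. repeat split; trivial. intros H. apply H1.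
      replace (1 - q ^ S k) with (- (q ^ S k - 1)) by ring. rewrite H. ring.
    * field. apply Cpow_nz. intros H. apply C1_nz.
      replace (1 : C) with (- - (1)) by ring. rewrite H. ring.
  + apply Z.div_unique_exact; [easy |]. pose proof (triangular_double k). nia.
Qed.

(** The summands 1 and q^(k+1) of the factor 1 + q^(k+1) in [limit_weight k] correspond to the
    negative and the positive index. *)
Lemma bilateral_series (V : C) :
  Cis_series (fun k => limit_weight k * square_term k * square_term k) V ->
  exists U1 U2 : C,
    Cis_series (fun k => bilateral_term q (Z.of_nat (S k))) U1 /\
    Cis_series (fun k => bilateral_term q (- Z.of_nat (S k))) U2 /\
    U1 + U2 = - V.
Proof using hq.
intros HV.
assert (Hb : forall k, (Cmod (- ((- (1)) ^ k * q ^ triangular k)) <= 1)%R).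
{ intros k. rewrite Cmod_opp, Cmod_mult, (Cmod_pow (- (1))), Cmod_opp, Cmod_1, pow1,
    Rmult_1_l. apply Cmod_Cpow_le_1. }
destruct (weighted_square_series
  (fun k => - ((- (1)) ^ k * q ^ triangular k * q ^ S k)) 1) as [U1 H1].
{ intros k. specialize (Hb k).
  replace (- ((- (1)) ^ k * q ^ triangular k * q ^ S k))
    with (- ((- (1)) ^ k * q ^ triangular k) * q ^ S k) by ring.
  rewrite Cmod_mult. pose proof (Cmod_Cpow_le_1 (S k)).
  pose proof (Cmod_ge_0 (q ^ S k)).
  pose proof (Cmod_ge_0 (- ((- (1)) ^ k * q ^ triangular k))). nra. }
destruct (weighted_square_series
  (fun k => - ((- (1)) ^ k * q ^ triangular k)) 1 Hb) as [U2 H2].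
exists U1, U2. repeat split.
- revert H1. apply Cis_series_ext. intros k. now rewrite bilateral_term_pos.
- revert H2. apply Cis_series_ext. intros k. now rewrite bilateral_term_neg.
- rewrite Cis_series_Clim in HV, H1, H2.
  refine (Clim_unique _ _ _ (Clim_opp _ _ HV) (Clim_ext _ _ _ _ (Clim_plus _ _ _ _ H1 H2))).
  intros n. cbv beta.
  induction n as [| n IH]; rewrite ?Csum_0, ?Csum_S.
  + unfold limit_weight. ring.
  + rewrite Copp_plus_distr, <- IH. unfold limit_weight. ring.
Qed.

(** Since (q^(n1+1);q)_oo = p/(q;q)_n1, the factor (q;q)_n1 cancels the one in [inner_series] and
    the outer term becomes a_n1 (A - s_n1) / p. *)
Lemma outer_series (p A V : C) :
  p <> 0 -> Clim (qpoch q q) p -> Cis_series square_term A ->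
  Clim (Csum (fun m => square_term m * Csum square_term m)) V ->
  Cis_series (fun m => outer_term q (S m)) (/ p * (A * A - V)).
Proof using hq.
intros Hp HP HA HV.
apply (Cis_series_ext (fun m => / p * (square_term m * (A - Csum square_term m)))).
- intros m. unfold outer_term, Cseries_from1.
  rewrite (Cseries_unique _ _ (inner_series A m HA)).
  rewrite (qpoch_inf_unique _ _ (qpoch_inf_shift p (S m) HP)).
  unfold square_term. field.
  repeat split; trivial; apply qpoch_nz || apply one_minus_Cpow_nz.
- apply Cis_series_mult_l, Cis_series_Clim.
  apply (Clim_ext (fun n => A * Csum square_term n
    - Csum (fun m => square_term m * Csum square_term m) n)).
  + intros n. rewrite <- Csum_mult_l, <- Csum_minus.
    apply Csum_ext. intros; ring.
  + apply Clim_minus; trivial. apply Clim_mult; [apply Clim_const |].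
    now apply Cis_series_Clim.
Qed.

End Pochhammer.

Theorem theorem1p1 (q : C) (hq : (Cmod q < 1)%R) :
  (forall n : nat, exists l : C, is_qpoch_inf (q ^ (n + 1)) q l) /\
  (forall n1 : nat, (1 <= n1)%nat -> Cex_series_from1 (inner_term q n1)) /\
  Cex_series_from1 (outer_term q) /\
  Cex_series_from1 (lambert_term q) /\
  Cex_series_nonzeroZ (bilateral_term q) /\
  Cseries_from1 (outer_term q) =
    1 / qpoch_inf q q * Cseries_from1 (lambert_term q) ^ 2 +
    1 / qpoch_inf q q * Cseries_nonzeroZ (bilateral_term q).
Proof.
destruct (qpoch_lim q hq) as (p & Hp & HP & _).
destruct (square_series q hq) as [A HA].
destruct (limit_weight_series q hq) as (V & HV & HV').
destruct (bilateral_series q hq V HV) as (U1 & U2 & HU1 & HU2 & HU).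
pose proof (outer_series q hq p A V Hp HP HA HV') as HO.
pose proof (lambert_series q hq A HA) as HL.
repeat split.
- intros n. eexists. exact (qpoch_inf_shift q hq p n HP).
- intros [| m] Hm; [lia |]. eexists. exact (inner_series q hq A m HA).
- now exists (/ p * (A * A - V)).
- now exists A.
- now exists U1.
- now exists U2.
- unfold Cseries_nonzeroZ, Cseries_from1.
  rewrite (Cseries_unique _ _ HO), (Cseries_unique _ _ HL),
    (Cseries_unique _ _ HU1), (Cseries_unique _ _ HU2), HU.
  rewrite (qpoch_inf_unique q q p) by now apply Clim_filterlim.
  field. trivial.
Qed.
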